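(* Let $n\ge1$. For all compositions $\alpha\in\mathcal{C}_n=(\mathbb{Z}_{\ge0})^n$ we have $$O_\alpha(x)=\frac{G_\alpha(t^{1-n}a\,w_0x)}{G_\alpha(a\tau)},$$ where $w_0x=(x_n,\dots,x_1)$, $G_\alpha$ is the non-symmetric interpolation Macdonald polynomial and $O_\alpha$ is the interpolation $O$-polynomial.
   Context: Let $q,t,a$ be indeterminates, $\mathbb{F}=\mathbb{Q}(q,t)$, $\mathbb{K}=\mathbb{Q}(q,t,a)$, $x=(x_1,\dots,x_n)$. For $v\in\mathbb{Z}^n$ put $|v|=v_1+\cdots+v_n$ and define $\overline{v}\in\mathbb{F}^n$ by $\overline{v}_i:=q^{v_i}t^{-k_i(v)}$ with $k_i(v):=\#\{k<i\mid v_k\ge v_i\}+\#\{k>i\mid v_k>v_i\}$. Put $\widetilde{v}:=\overline{-w_0v}$, where $w_0v=(v_n,\dots,v_1)$. Put $\tau=(1,t^{-1},\dots,t^{1-n})$. For $y\in\mathbb{K}^n$ with nonzero entries, $y^{-1}:=(y_1^{-1},\dots,y_n^{-1})$. For $\alpha\in\mathcal{C}_n$, $G_\alpha(x)=G_\alpha(x;q,t)\in\mathbb{F}[x_1,\dots,x_n]$ is the unique polynomial of degree at most $|\alpha|$ such that $G_\alpha(\overline{\beta})=0$ for all $\beta\in\mathcal{C}_n$ with $|\beta|\le|\alpha|$, $\beta\ne\alpha$, and such that the coefficient of $x^\alpha=x_1^{\alpha_1}\cdots x_n^{\alpha_n}$ in $G_\alpha$ is $1$ (existence and uniqueness are known,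 as is $G_\alpha(a\tau)\ne0$). The $O$-polynomial $O_\alpha(x)=O_\alpha(x;q,t;a)\in\mathbb{K}[x_1,\dots,x_n]$ is the unique polynomial of degree at most $|\alpha|$ such that $O_\alpha(\overline{\beta}^{-1})=\dfrac{G_\beta(a\widetilde{\alpha})}{G_\beta(a\tau)}$ for all $\beta\in\mathcal{C}_n$ (existence and uniqueness are known). *)

(* Defs.v *)
From HB Require Import structures.
From mathcomp Require Import all_boot all_order all_algebra.
From mathcomp Require Import mpoly.

Set Implicit Arguments.
Unset Strict Implicit.
Unset Printing Implicit Defensive.

Import Order.TTheory GRing.Theory Num.Theory.
Local Open Scope ring_scope.

Definition QQqt : Type := {fraction {mpoly rat[2]}}.
HB.instance Definition _ := GRing.Field.on QQqt.

Definition q : QQqt := tofrac ('X_(ord0 : 'I_2) : {mpoly rat[2]}).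
Definition t : QQqt := tofrac ('X_(ord_max : 'I_2) : {mpoly rat[2]}).

(* Q(q,t,a) is realized as Q(q,t)(a), so that Q(q,t) embeds as the constants. *)
Definition QQqta : Type := {fraction {poly QQqt}}.
HB.instance Definition _ := GRing.Field.on QQqta.

Definition a : QQqta := tofrac ('X : {poly QQqt}).
Definition toK : QQqt -> QQqta := @tofrac {poly QQqt} \o @polyC QQqt.
HB.instance Definition _ := GRing.RMorphism.on toK.

(* Indices are shifted to 0, ..., n-1; compositions with n parts are the *)
(* multi-exponents 'X_{1..n}, and |alpha| is mdeg alpha. *)
Section Interpolation.
Variable n : nat.
Implicit Types (v : 'I_n -> int) (alpha beta : 'X_{1..n}).

Definition w0 (T : Type) (v : 'I_n -> T) : 'I_n -> T := fun i => v (rev_ord i).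

Definition intv alpha : 'I_n -> int := fun i => (alpha i)%:Z.

Definition kstat v (i : 'I_n) : nat :=
  (#|[set k : 'I_n | (k < i)%N && (v i <= v k)%R]|
   + #|[set k : 'I_n | (i < k)%N && (v i < v k)%R]|)%N.

Definition bar v : 'I_n -> QQqt := fun i => q ^ v i * t ^- kstat v i.

Definition tilde v : 'I_n -> QQqt := bar (fun i => - w0 v i).

Definition tau : 'I_n -> QQqt := fun i => t ^- i.

(* The bound on msize says that the total degree is at most |alpha|, as msize *)
(* is one more than the total degree, and 0 at the zero polynomial. *)
Definition is_interpolation_Macdonald alpha (P : {mpoly QQqt[n]}) : Prop :=
  [/\ (msize P <= (mdeg alpha).+1)%N,
      forall beta, (mdeg beta <= mdeg alpha)%N -> beta != alpha ->
        P.@[bar (intv beta)] = 0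
    & P@_alpha = 1].

Definition scalars_to_K (P : {mpoly QQqt[n]}) : {mpoly QQqta[n]} := map_mpoly toK P.

Definition eval_a (P : {mpoly QQqt[n]}) (y : 'I_n -> QQqt) : QQqta :=
  (scalars_to_K P).@[fun i => a * toK (y i)].

Definition is_O_polynomial (G : 'X_{1..n} -> {mpoly QQqt[n]}) alpha
    (P : {mpoly QQqta[n]}) : Prop :=
  (msize P <= (mdeg alpha).+1)%N /\
  forall beta,
    P.@[fun i => (toK (bar (intv beta) i))^-1]
    = eval_a (G beta) (tilde (intv alpha)) / eval_a (G beta) tau.

End Interpolation.

(* Main.v *)
From HB Require Import structures.
Require Import Defs.
From mathcomp Require Import all_boot all_order all_fingroup all_algebra.
From mathcomp Require Import mpoly ring zify.

Set Implicit Arguments.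
Unset Strict Implicit.
Unset Printing Implicit Defensive.

Import Order.TTheory GRing.Theory Num.Theory.
Local Open Scope ring_scope.

(* Since [tilde beta] is [t^(1-n) w0 (bar beta)^-1], the claim is equivalent  *)
(* to the duality f(alpha, beta) = f(beta, alpha) for                          *)
(* f(alpha, beta) = G_alpha(a tilde beta) / G_alpha(a tau), because a          *)
(* polynomial of degree at most d is determined by its values at the points    *)
(* (bar beta)^-1 with |beta| <= d.  Every composition is reached from 0 by     *)
(* exchanging adjacent unequal parts and by the raising map                    *)
(* r(alpha) = (alpha_2, ..., alpha_n, alpha_1 + 1).  On G_alpha these moves    *)
(* are realized by Demazure-Lusztig operators and by the operator              *)
(* P -> (x_n - t^(1-n)) P(x_n / q, x_1, ..., x_(n-1)), whose values at         *)
(* a tilde beta are in turn expressed by the same moves applied to beta.  So f *)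
(* and its transpose satisfy the same recursion, with value 1 at alpha = 0.    *)
(* The factor in the recursion for r is f(alpha, r(0)): it is a telescoping    *)
(* product when alpha is an iterate of r at 0, and the existence of O_(r(0)),  *)
(* which is affine, then gives it for every alpha.                             *)

(** The duality is proved over any field with [generic] parameters, for any nonzero [g alpha] with
    the degree bound and the vanishing property: the ratio f, called [dual_ratio], is insensitive to
    rescaling [g alpha]. Its two recursions are [ratio_raiseE] and [ratio_mswap]; [composition_ind]
    combines them into the symmetry [ratio_sym], and [spectral_unisolvent] with [q] and [t] inverted
    then gives [O_polynomial_eq]. *)

(** * Substitution of polynomials of degree at most one *)

Lemma mnm_ind n (P : 'X_{1..n} -> Prop) :
  P 0%MM -> (forall i m, P m -> P (U_(i) + m)%MM) -> forall m, P m.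
Proof.
move=> P0 PS m; have [d] := ubnP (mdeg m); elim: d m => // d IHd m ltd.
have [->//|] := eqVneq m 0%MM.
rewrite -mdeg_eq0 mdegE sum_nat_eq0 negb_forall => /existsP[i /= mi].
have lem : (U_(i) <= m)%MM.
  by apply/mnm_lepP => j; rewrite mnm1E; case: eqVneq => // <-; rewrite lt0n.
move: ltd; rewrite -(submK lem) addmC mdegD mdeg1 => ltd.
exact/PS/IHd.
Qed.

Section Substitution.
Variable R : fieldType.

Lemma msizeM_leq n (P Q : {mpoly R[n]}) :
  (msize (P * Q) <= (msize P + msize Q).-1)%N.
Proof.
have [->|P0] := eqVneq P 0; first by rewrite mul0r mmeasure0.
have [->|Q0] := eqVneq Q 0; first by rewrite mulr0 mmeasure0.
by rewrite msizeM.
Qed.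

Lemma msizeD_leq n d (P Q : {mpoly R[n]}) :
  (msize P <= d)%N -> (msize Q <= d)%N -> (msize (P + Q) <= d)%N.
Proof.
by move=> sP sQ; apply: leq_trans (msizeD_le _ _) _; rewrite geq_max sP.
Qed.

Lemma msizeZ_leq n d c (P : {mpoly R[n]}) :
  (msize P <= d)%N -> (msize (c *: P) <= d)%N.
Proof. exact/leq_trans/msizeZ_le. Qed.

Lemma msizeB_leq n d (P Q : {mpoly R[n]}) :
  (msize P <= d)%N -> (msize Q <= d)%N -> (msize (P - Q) <= d)%N.
Proof. by move=> sP sQ; apply: msizeD_leq; rewrite ?msizeN. Qed.

Definition msubst n k (h : 'I_n -> {mpoly R[k]}) (P : {mpoly R[n]}) :=
  P \mPo [tuple h i | i < n].

Section Msubst.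
Variables n k : nat.
Implicit Types (h : 'I_n -> {mpoly R[k]}) (P : {mpoly R[n]}).

HB.instance Definition _ h := GRing.RMorphism.copy (msubst h) (comp_mpoly [tuple h i | i < n]).
HB.instance Definition _ h := GRing.Linear.copy (msubst h) (comp_mpoly [tuple h i | i < n]).

Lemma msubstX h i : msubst h 'X_i = h i.
Proof. by rewrite /msubst comp_mpolyXU -tnth_nth tnth_mktuple. Qed.

Lemma msubstE h P : msubst h P = \sum_(m <- msupp P) P@_m *: msubst h 'X_[m].
Proof.
rewrite {1}[P]mpolyE raddf_sum; apply: eq_bigr => m _; exact: linearZ.
Qed.

Lemma eq_msubst h h' P : h =1 h' -> msubst h P = msubst h' P.
Proof.
by move=> hh; rewrite /msubst; congr (_ \mPo _); apply: eq_mktuple.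
Qed.

Lemma msubst_eval h P v : (msubst h P).@[v] = P.@[fun i => (h i).@[v]].
Proof.
by rewrite /msubst comp_mpoly_meval; apply: meval_eq => i; rewrite tnth_mktuple.
Qed.

Lemma msubstXU h i m : msubst h 'X_[U_(i) + m] = h i * msubst h 'X_[m].
Proof. by rewrite mpolyXD rmorphM /= msubstX. Qed.

Lemma msize_msubst h P : (forall i, (msize (h i) <= 2)%N) ->
  (msize (msubst h P) <= msize P)%N.
Proof.
move=> sh; rewrite msubstE.
apply: leq_trans (msize_sum _ _ _) _; apply/bigmax_leqP_seq => m Pm _.
apply: msizeZ_leq; apply: leq_trans (msize_mdeg_lt Pm).
elim/mnm_ind: m {Pm} => [|i m IHm].
  by rewrite mpolyX0 rmorph1 msize1.
rewrite msubstXU mdegD mdeg1; apply: leq_trans (msizeM_leq _ _) _.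
have := leq_add (sh i) IHm; lia.
Qed.

(** The two substitutions agree on the hyperplane where [l] vanishes; on monomials a Leibniz rule
    produces the cofactor and its degree. This serves both to divide by the equation of a hyperplane
    and to form divided differences. *)
Lemma msubst_divide {h h'} {l : {mpoly R[k]}} (eps : 'I_n -> R) P :
  (forall i, (msize (h i) <= 2)%N) -> (forall i, (msize (h' i) <= 2)%N) ->
  (forall i, h i - h' i = eps i *: l) ->
  exists2 g, (msize g <= (msize P).-1)%N & msubst h P - msubst h' P = l * g.
Proof.
move=> sh sh' hh.
have mon m : exists2 g : {mpoly R[k]}, (msize g <= mdeg m)%N &
   msubst h 'X_[m] - msubst h' 'X_[m] = l * g.
  elim/mnm_ind: m => [|i m [g sg IHm]].
    by exists 0; rewrite ?mmeasure0 // mpolyX0 !rmorph1 subrr mulr0.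
  exists (h i * g + eps i *: msubst h' 'X_[m]).
    apply: msizeD_leq.
      by apply: leq_trans (msizeM_leq _ _) _; rewrite mdegD mdeg1; have := sh i; lia.
    apply: msizeZ_leq; apply: leq_trans (msize_msubst _ sh') _.
    by rewrite msizeX mdegD mdeg1.
  rewrite !msubstXU.
  rewrite (_ : _ - _ = h i * (msubst h 'X_[m] - msubst h' 'X_[m])
               + (h i - h' i) * msubst h' 'X_[m]); last by ring.
  by rewrite IHm hh mulrDr mulrCA -scalerAl -scalerAr.
have -> : msubst h P - msubst h' P =
    \sum_(m <- msupp P) P@_m *: (msubst h 'X_[m] - msubst h' 'X_[m]).
  by rewrite !(msubstE _ P) -sumrB; apply: eq_bigr => m _; rewrite scalerBr.
rewrite big_seq; elim/big_rec: _ => [|m p Pm [g sg ->]].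
  by exists 0; rewrite ?mmeasure0 ?mulr0.
have [g' sg' e] := mon m; exists (P@_m *: g' + g).
  apply: msizeD_leq => //; apply: msizeZ_leq; apply: leq_trans sg' _.
  by have := msize_mdeg_lt Pm; lia.
by rewrite e mulrDr scalerAr.
Qed.

End Msubst.

Lemma msubst_comp n k l (h : 'I_n -> {mpoly R[k]}) (h' : 'I_k -> {mpoly R[l]}) P :
  msubst h' (msubst h P) = msubst (fun i => msubst h' (h i)) P.
Proof.
rewrite (msubstE h P) linear_sum [RHS]msubstE; apply: eq_bigr => m _.
rewrite linearZ /=; congr (_ *: _).
elim/mnm_ind: m => [|i m IHm]; first by rewrite mpolyX0 !rmorph1.
by rewrite !msubstXU rmorphM /= IHm.
Qed.

Lemma msubst_id n (h : 'I_n -> {mpoly R[n]}) P : (forall i, h i = 'X_i) -> msubst h P = P.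
Proof.
move=> hE; rewrite -[RHS]comp_mpoly_id /msubst; congr (_ \mPo _).
by apply: eq_from_tnth => i; rewrite !tnth_mktuple.
Qed.

Lemma affine_meval n (P : {mpoly R[n]}) : (msize P <= 2)%N ->
  exists c0 c, forall v, P.@[v] = c0 + \sum_i c i * v i.
Proof.
move=> sP; rewrite [P]mpolyE big_seq; elim/big_rec: _ => [|m p Pm [c0 [c IH]]].
  exists 0, (fun=> 0) => v; rewrite meval0 big1 ?addr0 // => i _; exact: mul0r.
have := leq_trans (msize_mdeg_lt Pm) sP; rewrite ltnS leq_eqVlt => /orP[/mdeg1P[j /eqP->]|].
  exists c0, (fun i => c i + P@_U_(j) * (i == j)%:R) => v.
  rewrite mevalD mevalZ mevalXU IH addrCA; congr (_ + _).
  rewrite [X in _ = X](eq_bigr (fun i => P@_U_(j) * (i == j)%:R * v i + c i * v i));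
    last by move=> i _; ring.
  rewrite big_split /=; congr (_ + _).
  rewrite (bigD1 j) //= eqxx mulr1 big1 ?addr0 // => i /negPf->.
  by rewrite mulr0 mul0r.
rewrite ltnS leqn0 mdeg_eq0 => /eqP->.
by exists (P@_0 + c0), c => v; rewrite mevalD mevalZ mpolyX0 meval1 mulr1 IH addrA.
Qed.

End Substitution.

(** * Compositions *)

Section Compositions.

Local Notation widen := (widen_ord (leqnSn _)).

(** Sort the parts in decreasing order, ties from left to right: [k] beats [i] when it comes
    earlier, so [rank] is the position of [i], counted from 0. *)
Definition beats n (alpha : 'X_{1..n}) (k i : 'I_n) : bool :=
  (k < i)%N && (alpha i <= alpha k)%N || (i < k)%N && (alpha i < alpha k)%N.

Definition rank n (alpha : 'X_{1..n}) (i : 'I_n) : nat :=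
  (\sum_k beats alpha k i)%N.

Lemma card_set_sum n (P : pred 'I_n) : #|[set k | P k]| = (\sum_k P k)%N.
Proof. by rewrite cardsE -sum1_card big_mkcond. Qed.

Lemma kstat_rank n (alpha : 'X_{1..n}) i : kstat (intv alpha) i = rank alpha i.
Proof.
rewrite /kstat !card_set_sum -big_split; apply: eq_bigr => k _ /=.
rewrite /beats /intv; lia.
Qed.

Lemma rank0 n i : rank (0 : 'X_{1..n})%MM i = i.
Proof.
rewrite /rank (eq_bigr (fun k : 'I_n => (k < i)%N : nat)).
  by rewrite -[RHS]card_ord -sum1_card (big_ord_widen n (fun=> 1%N)) 1?ltnW // [RHS]big_mkcond.
by move=> k _; rewrite /beats !mnm0E; lia.
Qed.

Definition raise n (alpha : 'X_{1..n.+1}) : 'X_{1..n.+1} :=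
  [multinom (alpha (ordS i) + (i == ord_max))%N | i < n.+1].

Definition mswap n (i j : 'I_n) (alpha : 'X_{1..n}) : 'X_{1..n} :=
  [multinom alpha (tperm i j k) | k < n].

Lemma val_ordS n (i : 'I_n.+1) : ordS i = (if i == ord_max then 0 else i.+1)%N :> nat.
Proof.
rewrite /=; case: eqVneq => [->|]; first by rewrite modnn.
rewrite -val_eqE /= => ni; rewrite modn_small //; have := ltn_ord i; lia.
Qed.

(** The first part wins its ties by standing on the left. At the right end it would lose them, and
    the added 1 makes up for exactly that. *)
Lemma rank_raise n (alpha : 'X_{1..n.+1}) i : rank (raise alpha) i = rank alpha (ordS i).
Proof.
rewrite /rank [RHS](reindex_inj (@ordS_inj _)); apply: eq_bigr => k _; congr (nat_of_bool _).
rewrite /beats !mnmE !val_ordS.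
have := ltn_ord i; have := ltn_ord k; rewrite -!val_eqE /=.
case: (eqVneq (k : nat) n) => [ek|nk]; case: (eqVneq (i : nat) n) => [ei|ni]; lia.
Qed.

Lemma mdeg_raise n (alpha : 'X_{1..n.+1}) : mdeg (raise alpha) = (mdeg alpha).+1.
Proof.
rewrite !mdegE (eq_bigr _ (fun i _ => mnmE _ _)) big_split /= -[RHS]addn1; congr (_ + _)%N.
  by rewrite [RHS](reindex_inj (@ordS_inj _)).
by rewrite (bigD1 ord_max) //= eqxx big1 // => i /negPf ->.
Qed.

Lemma raise_surj n (alpha : 'X_{1..n.+1}) : (0 < alpha ord_max)%N ->
  exists beta, alpha = raise beta.
Proof.
move=> apos; exists [multinom (alpha (ord_pred i) - (ord_pred i == ord_max))%N | i < n.+1].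
apply/mnmP => i; rewrite !mnmE ordSK; case: eqVneq => [->|] /=; first by rewrite subnK.
by rewrite subn0 addn0.
Qed.

Section Swap.
Variables (n : nat) (i j : 'I_n) (ij : j = i.+1 :> nat).
Implicit Types alpha : 'X_{1..n}.

Lemma mswapK : involutive (mswap i j).
Proof. by move=> alpha; apply/mnmP => k; rewrite !mnmE tpermK. Qed.

Lemma mdeg_mswap alpha : mdeg (mswap i j alpha) = mdeg alpha.
Proof.
rewrite !mdegE [RHS](reindex_inj (@perm_inj _ (tperm i j))).
by apply: eq_bigr => k _; rewrite mnmE.
Qed.

Lemma mswap_id alpha : alpha i = alpha j -> mswap i j alpha = alpha.
Proof. by move=> e; apply/mnmP => k; rewrite mnmE; case: tpermP => // ->. Qed.

Lemma rank_mswap alpha k : alpha i != alpha j ->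
  rank (mswap i j alpha) k = rank alpha (tperm i j k).
Proof.
move=> nij; rewrite /rank [RHS](reindex_inj (@perm_inj _ (tperm i j))).
apply: eq_bigr => l _; congr (nat_of_bool _); rewrite /beats !mnmE.
have vi (x y : 'I_n) : x <> y -> (x : nat) <> y by move=> nxy /val_inj.
by case: (tpermP i j k) => [->|->|/vi ki /vi kj]; case: (tpermP i j l) => [->|->|/vi li /vi lj]; lia.
Qed.

Lemma rank_eqS alpha : alpha i = alpha j -> rank alpha j = (rank alpha i).+1.
Proof.
move=> e; rewrite /rank -addn1.
rewrite (eq_bigr (fun k => beats alpha k i + (k == i))%N).
  by rewrite big_split /=; congr (_ + _)%N; rewrite (bigD1 i) //= eqxx big1 // => k /negPf->.
move=> k _; rewrite /beats -val_eqE e /=.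
have [/val_inj ->|kj] := eqVneq (k : nat) j; first lia.
by have [/val_inj ->|ki] := eqVneq (k : nat) i; lia.
Qed.

End Swap.

(** Induction on the degree, then on the distance of a nonzero part from the last position. If the
    last part is nonzero, the composition is raised from a smaller one; otherwise either the next
    part is nonzero too, or an exchange moves the nonzero part one step to the right. *)
Lemma composition_ind n (P : 'X_{1..n.+1} -> Prop) :
  P 0%MM -> (forall alpha, P alpha -> P (raise alpha)) ->
  (forall (i j : 'I_n.+1) (alpha : 'X_{1..n.+1}), j = i.+1 :> nat -> alpha i != alpha j ->
     P alpha -> P (mswap i j alpha)) ->
  forall alpha, P alpha.
Proof.
move=> P0 Praise Pswap alpha.
have [d] := ubnP (mdeg alpha); elim: d alpha => // d IHd alpha ltd.
have [->//|] := eqVneq alpha 0%MM.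
rewrite -mdeg_eq0 mdegE sum_nat_eq0 negb_forall => /existsP[j /= aj].
have [k] : exists k, (n - j = k)%N by exists (n - j)%N.
elim: k alpha ltd j aj => [|k IHk] alpha ltd j aj kE.
  have jmax : j = ord_max by apply: val_inj => /=; have := ltn_ord j; lia.
  have [beta e] : exists beta, alpha = raise beta by apply: raise_surj; rewrite -jmax lt0n.
  by rewrite e; apply/Praise/IHd; move: ltd; rewrite e mdeg_raise.
have ltj : (j.+1 < n.+1)%N by lia.
pose j' := Ordinal ltj.
have [a0|] := eqVneq (alpha j') 0%N; last by move/IHk; apply=> //=; lia.
rewrite -(mswapK j j' alpha); apply: Pswap => //.
  by rewrite !mnmE tpermL tpermR a0 eq_sym.
by apply: (IHk _ _ j'); rewrite ?mdeg_mswap //= ?mnmE ?tpermR //; lia.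
Qed.

Lemma rank_widen n (beta : 'X_{1..n}) i : rank (mnmwiden beta) (widen i) = rank beta i.
Proof.
rewrite /rank big_ord_recr /= {2}/beats mnmwiden_ordmax /= ltn0 andbF orbF.
rewrite ltnNge ltnW //= addn0; apply: eq_bigr => k _.
by rewrite /beats !mnmwiden_widen.
Qed.

Lemma rank_last0 n (alpha : 'X_{1..n.+1}) :
  alpha ord_max = 0%N -> rank alpha ord_max = n.
Proof.
move=> a0; rewrite /rank big_ord_recr /= {2}/beats ltnn /= addn0 -[RHS]card_ord -sum1_card.
by apply: eq_bigr => k _; rewrite /beats a0 /= ltn_ord.
Qed.

Lemma mdeg_widen n (beta : 'X_{1..n}) : mdeg (mnmwiden beta) = mdeg beta.
Proof.
rewrite !mdegE big_ord_recr /= mnmwiden_ordmax addn0.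
by apply: eq_bigr => k _; rewrite mnmwiden_widen.
Qed.

End Compositions.

(** * Interpolation at the spectral points *)

Section SpectralPoints.
Variables (L : fieldType) (q t : L).

(** Only exponents of [q] have to be separated; [t] may be a root of unity. The condition is stable
    under inverting both parameters, as the points (bar beta)^-1 require. *)
Definition generic := [/\ q != 0, t != 0 &
  forall m k m' k' : nat, q ^+ m * t ^+ k = q ^+ m' * t ^+ k' -> m = m'].

Definition spectral n (alpha : 'X_{1..n}) (i : 'I_n) : L :=
  q ^+ alpha i / t ^+ rank alpha i.

Hypothesis qt_gen : generic.
Let q_neq0 : q != 0. Proof. by case: qt_gen. Qed.
Let t_neq0 : t != 0. Proof. by case: qt_gen. Qed.

Lemma generic_frac m k m' k' : q ^+ m / t ^+ k = q ^+ m' / t ^+ k' -> m = m'.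
Proof.
move/eqP; rewrite eqr_div ?expf_neq0 // => /eqP; case: qt_gen => _ _; exact.
Qed.

Lemma spectral_neq0 n (alpha : 'X_{1..n}) i : spectral alpha i != 0.
Proof. by rewrite mulf_neq0 ?invr_eq0 ?expf_neq0. Qed.

Lemma spectral0 n i : spectral (0 : 'X_{1..n})%MM i = (t ^+ i)^-1.
Proof. by rewrite /spectral mnm0E rank0 mul1r. Qed.

Lemma spectral_inj n (alpha : 'X_{1..n}) i j :
  spectral alpha i = spectral alpha j -> alpha i = alpha j.
Proof. exact: generic_frac. Qed.

Lemma spectral_raise n (alpha : 'X_{1..n.+1}) i : spectral (raise alpha) i =
  (if i == ord_max then q else 1) * spectral alpha (ordS i).
Proof.
rewrite /spectral rank_raise mnmE mulrA; case: eqP => _; last by rewrite addn0 mul1r.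
by rewrite addn1 exprS.
Qed.

Lemma spectral_last0 n (alpha : 'X_{1..n.+1}) :
  alpha ord_max = 0%N -> spectral alpha ord_max = (t ^+ n)^-1.
Proof. by move=> a0; rewrite /spectral rank_last0 // a0 mul1r. Qed.

Lemma spectral_widen n (beta : 'X_{1..n}) i :
  spectral (mnmwiden beta) (widen_ord (leqnSn _) i) = spectral beta i.
Proof. by rewrite /spectral mnmwiden_widen rank_widen. Qed.

Section Adjacent.
Variables (n : nat) (i j : 'I_n) (ij : j = i.+1 :> nat).
Implicit Types alpha : 'X_{1..n}.

Lemma spectral_mswap alpha k : alpha i != alpha j ->
  spectral (mswap i j alpha) k = spectral alpha (tperm i j k).
Proof. by move=> nij; rewrite /spectral rank_mswap // mnmE. Qed.

Lemma spectral_eq alpha : alpha i = alpha j -> spectral alpha i = t * spectral alpha j.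
Proof.
by move=> e; rewrite /spectral (rank_eqS ij e) e exprS; field; rewrite t_neq0 expf_neq0.
Qed.

Lemma spectral_neq_t alpha : alpha i != alpha j -> spectral alpha i != t * spectral alpha j.
Proof.
apply: contra_neq => e; apply: (@generic_frac _ (rank alpha i).+1 _ (rank alpha j)).
by rewrite exprS invfM mulrCA -/(spectral alpha i) e mulKf.
Qed.

End Adjacent.

Definition rotate n (x : 'I_n.+1 -> L) (i : 'I_n.+1) : L :=
  (if i == ord0 then q^-1 else 1) * x (ord_pred i).

Definition rotate_var n (i : 'I_n.+1) : {mpoly L[n.+1]} :=
  (if i == ord0 then q^-1 else 1) *: 'X_(ord_pred i).

Lemma ordS_eq0 n (i : 'I_n.+1) : (ordS i == ord0) = (i == ord_max).
Proof. by rewrite -[LHS]/((ordS i : nat) == 0%N) val_ordS; case: (i == ord_max). Qed.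

Lemma rotate_raise n (alpha : 'X_{1..n.+1}) : rotate (spectral (raise alpha)) =1 spectral alpha.
Proof.
move=> i; rewrite /rotate spectral_raise ord_predK -ordS_eq0 ord_predK mulrA.
by case: eqP => _; rewrite ?mulVf // ?mul1r.
Qed.

Lemma rotate_var_eval n (x : 'I_n.+1 -> L) i : (rotate_var i).@[x] = rotate x i.
Proof. by rewrite /rotate_var mevalZ mevalXU. Qed.

Lemma msize_XU n (i : 'I_n) : msize ('X_i : {mpoly L[n]}) = 2.
Proof. by rewrite msizeX mdeg1. Qed.

Lemma msize_rotate_var n (i : 'I_n.+1) : (msize (rotate_var i) <= 2)%N.
Proof. by apply: msizeZ_leq; rewrite msize_XU. Qed.

(* The spectral points of the compositions with last part 0 lie on the *)
(* hyperplane [x_n = t^(1-n)]: by induction on [n], [P] vanishes there and is a *)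
(* multiple of [x_n - t^(1-n)].  The cofactor vanishes at the spectral points of *)
(* the raised compositions, hence is 0 by induction on [d]. *)
Theorem spectral_unisolvent n d (P : {mpoly L[n]}) : (msize P <= d.+1)%N ->
  (forall beta, (mdeg beta <= d)%N -> P.@[spectral beta] = 0) -> P = 0.
Proof.
elim: n d P => [|n IHn] d P.
  move=> _ /(_ 0%MM); rewrite mdeg0 => /(_ isT).
  have /msize1_polyC -> : (msize P <= 1)%N.
    by rewrite msizeE; apply/bigmax_leqP_seq => m _ _; rewrite mdegE big_ord0.
  by rewrite mevalC => ->.
elim: d P => [|d IHd] P sP P0.
  move: (P0 0%MM); rewrite mdeg0 => /(_ isT).
  by rewrite (msize1_polyC sP) mevalC => ->.
pose c := (t ^+ n)^-1.
(* Restriction to the hyperplane, first as a polynomial in one variable fewer, then in all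
   variables. *)
pose res (i : 'I_n.+1) : {mpoly L[n]} := oapp (fun j => 'X_j) c%:MP (unlift ord_max i).
pose res' (i : 'I_n.+1) : {mpoly L[n.+1]} := if i == ord_max then c%:MP else 'X_i.
have sC k : (msize (c%:MP : {mpoly L[k]}) <= 2)%N by rewrite msizeC; case: (_ != _).
have sres i : (msize (res i) <= 2)%N.
  by rewrite /res; case: unliftP => [j|] _ //=; rewrite msize_XU.
have sres' i : (msize (res' i) <= 2)%N by rewrite /res'; case: eqP => _; rewrite ?msize_XU.
have R0 : msubst res P = 0.
  apply: (IHn d.+1); first exact: leq_trans (msize_msubst _ sres) sP.
  move=> beta degb; rewrite msubst_eval -(P0 (mnmwiden beta)) ?mdeg_widen //.
  apply: meval_eq => i; rewrite /res; case: unliftP => [j ->|->] /=.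
    rewrite mevalXU -spectral_widen; congr (spectral _ _).
    by apply: val_inj; rewrite /= /bump leqNgt ltn_ord.
  by rewrite mevalC spectral_last0 ?mnmwiden_ordmax.
have R0' : msubst res' P = 0.
  transitivity (msubst (fun j => 'X_(lift ord_max j)) (msubst res P)); last first.
    by rewrite R0 rmorph0.
  rewrite msubst_comp; apply: eq_msubst => i; rewrite /res' /res; case: unliftP => [j ->|->] /=.
    by rewrite msubstX eq_sym (negPf (neq_lift _ _)).
  by rewrite eqxx [RHS]comp_mpolyC.
have [||g sg] := msubst_divide (h := fun i => 'X_i) (h' := res') (l := 'X_ord_max - c%:MP)
  (eps := fun i => (i == ord_max)%:R) P _ sres'.
- by move=> i; rewrite msize_XU.
- move=> i; rewrite /res'; case: eqP => [->|_]; first by rewrite scale1r.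
  by rewrite subrr scale0r.
rewrite R0' subr0 msubst_id // => Pg.
(* This substitution sends the spectral point of [beta] to that of [raise beta], so the induction on
   [d] applies to the shifted cofactor; [rotate_var] undoes it. *)
pose up (i : 'I_n.+1) : {mpoly L[n.+1]} :=
  (if i == ord_max then q else 1) *: 'X_(ordS i).
have sup i : (msize (up i) <= 2)%N by apply: msizeZ_leq; rewrite msize_XU.
have up0 : msubst up g = 0.
  apply: IHd; first by apply: leq_trans (msize_msubst _ sup) _; lia.
  move=> beta degb; rewrite msubst_eval.
  have e : (fun i => (up i).@[spectral beta]) =1 spectral (raise beta).
    by move=> i; rewrite /up mevalZ mevalXU spectral_raise.
  rewrite (meval_eq _ e); have := P0 (raise beta).
  rewrite mdeg_raise => /(_ degb) /eqP; rewrite Pg mevalM mulf_eq0 => /orP[|/eqP //].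
  rewrite mevalB mevalXU mevalC subr_eq0 => /eqP eP.
  (* On the hyperplane the exponent of [q] in the last coordinate would be 0, but a raised last part
     is positive. *)
  have /generic_frac : q ^+ raise beta ord_max / t ^+ rank (raise beta) ord_max = q ^+ 0 / t ^+ n.
    by rewrite -/(spectral _ _) eP mul1r.
  by rewrite mnmE eqxx addn1.
rewrite Pg -(msubst_id (h := fun i => msubst (@rotate_var n) (up i)) g).
  by rewrite -msubst_comp up0 rmorph0 mulr0.
move=> i; rewrite /up linearZ /= msubstX /rotate_var ordS_eq0 ordSK scalerA.
by case: eqP => _; rewrite ?mulfV // ?mulr1 scale1r.
Qed.

End SpectralPoints.

Lemma generic_inv (L : fieldType) (q t : L) : generic q t -> generic q^-1 t^-1.
Proof.
case=> q0 t0 qt; split; rewrite ?invr_eq0 // => m k m' k'.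
by rewrite !exprVn -!invfM => /invr_inj/qt.
Qed.

Lemma spectral_inv (L : fieldType) (q t : L) n (alpha : 'X_{1..n}) i :
  (spectral q t alpha i)^-1 = spectral q^-1 t^-1 alpha i.
Proof. by rewrite /spectral invfM !exprVn. Qed.

(** * Duality *)

Lemma rev_ord_eq_max n (i : 'I_n.+1) : (rev_ord i == ord_max) = (i == ord0).
Proof. by rewrite -!val_eqE /=; have := ltn_ord i; lia. Qed.

Lemma ordS_rev n (i : 'I_n.+1) : ordS (rev_ord (ordS i)) = rev_ord i.
Proof.
apply: ord_inj; rewrite val_ordS rev_ord_eq_max ordS_eq0.
have vr (k : 'I_n.+1) : rev_ord k = (n - k)%N :> nat by rewrite /= subSS.
rewrite !vr val_ordS; have := ltn_ord i.
case: eqVneq => [->|]; rewrite -?val_eqE /=; lia.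
Qed.

Section Duality.
Variables (L : fieldType) (q t a : L) (n : nat).
Hypothesis qt_gen : generic q t.
Hypothesis a_neq0 : a != 0.
Hypothesis a_gen : forall m k : nat, a * t ^+ k != q ^+ m.

Variable g : 'X_{1..n.+1} -> {mpoly L[n.+1]}.
Hypothesis g_size : forall alpha, (msize (g alpha) <= (mdeg alpha).+1)%N.
Hypothesis g_vanish : forall alpha beta, (mdeg beta <= mdeg alpha)%N ->
  beta != alpha -> (g alpha).@[spectral q t beta] = 0.
Hypothesis g_neq0 : forall alpha, g alpha != 0.

Let q_neq0 : q != 0. Proof. by case: qt_gen. Qed.
Let t_neq0 : t != 0. Proof. by case: qt_gen. Qed.
Implicit Types alpha beta : 'X_{1..n.+1}.
Local Notation bar := (spectral q t).

Lemma g_bar_neq0 alpha : (g alpha).@[bar alpha] != 0.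
Proof.
apply: contra_neq (g_neq0 alpha) => g0.
apply: (spectral_unisolvent qt_gen (g_size alpha)) => beta degb.
by have [->|/g_vanish->] := eqVneq beta alpha.
Qed.

Lemma g_unique alpha (P : {mpoly L[n.+1]}) : (msize P <= (mdeg alpha).+1)%N ->
  (forall beta, (mdeg beta <= mdeg alpha)%N -> beta != alpha -> P.@[bar beta] = 0) ->
  exists c, P = c *: g alpha.
Proof.
move=> sP P0; exists (P.@[bar alpha] / (g alpha).@[bar alpha]).
apply/eqP; rewrite -subr_eq0; apply/eqP.
apply: (spectral_unisolvent qt_gen (d := mdeg alpha)).
  by apply: msizeB_leq => //; apply: msizeZ_leq.
move=> beta degb; rewrite mevalB mevalZ.
have [->|nba] := eqVneq beta alpha; first by rewrite divfK ?subrr ?g_bar_neq0.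
by rewrite (P0 _ degb nba) (g_vanish degb nba) mulr0 subrr.
Qed.

(* [dual beta] is the point [a * tilde beta]. *)
Definition dual beta (i : 'I_n.+1) : L := a / t ^+ n / bar beta (rev_ord i).

Local Notation G alpha beta := ((g alpha).@[dual beta]).
Hypothesis G0_neq0 : forall alpha, G alpha 0%MM != 0.

Definition dual_ratio alpha beta : L := G alpha beta / G alpha 0%MM.

Lemma ratio0r alpha : dual_ratio alpha 0%MM = 1.
Proof. exact: mulfV. Qed.

Lemma ratio0l beta : dual_ratio 0%MM beta = 1.
Proof.
have := g_size 0%MM; rewrite mdeg0 => /msize1_polyC gE.
rewrite -(ratio0r 0%MM) /dual_ratio; congr (_ / _).
by rewrite gE !mevalC.
Qed.

(** Up to a power of [t], the value at [dual beta] of the linear factor in the raising operator. *)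
Definition weight beta : L := a / bar beta ord0 - 1.

Lemma weight_neq0 beta : weight beta != 0.
Proof.
rewrite subr_eq0 /spectral invfM invrK mulrCA -[1](mulVf (expf_neq0 (beta ord0) q_neq0)).
by rewrite (inj_eq (mulfI _)) ?invr_eq0 ?expf_neq0.
Qed.

Lemma rotate_dual beta : rotate q (dual beta) =1 dual (raise beta).
Proof.
move=> i; rewrite /rotate /dual spectral_raise //.
rewrite rev_ord_eq_max -[i in ordS (rev_ord i)]ord_predK ordS_rev.
by case: eqP => _; rewrite ?mul1r // !invfM mulrCA.
Qed.

(* The raising operator [f -> (x_n - t^(1-n)) f(x_n / q, x_1, ..., x_(n-1))] *)
(* shifts both the index of [g] and the point [dual beta]. *)
Lemma raise_eval alpha : exists c, forall beta,
  weight beta * G alpha (raise beta) = c * G (raise alpha) beta.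
Proof.
pose P : {mpoly L[n.+1]} := ('X_ord_max - ((t ^+ n)^-1)%:MP) * msubst (@rotate_var L q n) (g alpha).
have PE x : P.@[x] = (x ord_max - (t ^+ n)^-1) * (g alpha).@[rotate q x].
  rewrite mevalM mevalB mevalXU mevalC msubst_eval; congr (_ * _).
  by apply: meval_eq => i; rewrite rotate_var_eval.
have [||c Pc] := @g_unique (raise alpha) P.
- rewrite mdeg_raise; apply: leq_trans (msizeM_leq _ _) _.
  have := leq_trans (msize_msubst (g alpha) (@msize_rotate_var L q n)) (g_size alpha).
  have : (msize ('X_ord_max - ((t ^+ n)^-1)%:MP : {mpoly L[n.+1]}) <= 2)%N.
    by apply: msizeB_leq; rewrite ?msize_XU // msizeC; case: (_ != _).
  by lia.
- move=> beta; rewrite mdeg_raise PE => degb nba.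
  have [b0|] := eqVneq (beta ord_max) 0%N.
    by rewrite spectral_last0 // subrr mul0r.
  rewrite -lt0n => /raise_surj[gam bE]; move: degb nba; rewrite bE mdeg_raise => degg nga.
  rewrite (meval_eq _ (rotate_raise qt_gen gam)) g_vanish ?mulr0 //.
  by apply: contra_neq nga => ->.
exists (c * t ^+ n) => beta.
have := PE (dual beta); rewrite Pc mevalZ (meval_eq _ (rotate_dual beta)) => e.
rewrite mulrAC e mulrAC; congr (_ * _); rewrite /dual /weight.
have -> : rev_ord ord_max = ord0 :> 'I_n.+1 by apply: val_inj; rewrite /= subnn.
by field; rewrite expf_neq0 //= spectral_neq0.
Qed.

(** The unknown constant of [raise_eval] is eliminated by its instance at [beta = 0]. *)
Lemma ratio_raise alpha beta : weight beta * dual_ratio alpha (raise beta) =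
  weight 0%MM * dual_ratio alpha (raise 0%MM) * dual_ratio (raise alpha) beta.
Proof.
have [c cE] := raise_eval alpha.
rewrite /dual_ratio (mulrA (weight beta)) (mulrA (weight 0%MM)) !cE.
by field; rewrite !G0_neq0.
Qed.

(** * The ratio at one box *)

Local Notation row k := (iter k (@raise n) 0%MM).

Lemma row_weight_neq0 k : \prod_(j < k) weight (row j) != 0.
Proof. by apply/prodf_neq0 => j _; apply: weight_neq0. Qed.

(** Proved together with a product formula for [dual_ratio (row k)]: the box value at [k] makes the
    factor in [ratio_raise] explicit, which gives the product formula at [k.+1]; at
    [raise 0 = row 1] that product telescopes to the next box value. *)
Lemma ratio_row_box k :
  dual_ratio (row k) (raise 0%MM) = weight (row k) / weight 0%MM.
Proof.
suff [//] : dual_ratio (row k) (raise 0%MM) = weight (row k) / weight 0%MM /\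
  forall beta, dual_ratio (row k) beta * \prod_(j < k) weight (row j) =
    \prod_(j < k) weight (iter j (@raise n) beta).
have box m : (forall beta, dual_ratio (row m) beta * \prod_(j < m) weight (row j) =
    \prod_(j < m) weight (iter j (@raise n) beta)) ->
  dual_ratio (row m) (raise 0%MM) = weight (row m) / weight 0%MM.
  move=> prodE; apply: (mulIf (row_weight_neq0 m)); rewrite prodE.
  rewrite mulrAC; apply: (mulIf (weight_neq0 0%MM)).
  rewrite divfK ?weight_neq0 //; transitivity (\prod_(j < m.+1) weight (row j)).
    rewrite big_ord_recl mulrC; congr (_ * _).
    by apply: eq_bigr => j _; rewrite -iterSr.
  by rewrite big_ord_recr /= mulrC.
elim: k => [|k [IHbox IHprod]].
  have H0 beta : dual_ratio (row 0) beta * \prod_(j < 0) weight (row j) =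
      \prod_(j < 0) weight (iter j (@raise n) beta).
    by rewrite !big_ord0 mulr1 ratio0l.
  by split=> //; apply: box.
have H beta : dual_ratio (row k.+1) beta * \prod_(j < k.+1) weight (row j) =
    \prod_(j < k.+1) weight (iter j (@raise n) beta).
  have := ratio_raise (row k) beta.
  rewrite IHbox (mulrC (weight 0%MM)) divfK ?weight_neq0 // => e.
  rewrite big_ord_recr /= mulrC -mulrA -e mulrC [RHS]big_ord_recl -mulrA IHprod.
  by congr (_ * _); apply: eq_bigr => j _; rewrite -iterSr.
by split=> //; apply: box.
Qed.

Variable O : 'X_{1..n.+1} -> {mpoly L[n.+1]}.
Hypothesis O_size : forall alpha, (msize (O alpha) <= (mdeg alpha).+1)%N.
Hypothesis O_val : forall alpha beta,
  (O alpha).@[fun i => (bar beta i)^-1] = dual_ratio beta alpha.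

(** The inverse points of the rows are successive windows of length n+1 in the sequence 1, t, ...,
    t^n, q^-1, q^-1 t, ..., q^-1 t^n. *)
Lemma row_barV k i : (k <= n.+1)%N -> (bar (row k) i)^-1 =
  if (i + k <= n)%N then t ^+ (i + k) else q^-1 * t ^+ (i + k - n.+1).
Proof.
elim: k i => [|k IHk] i lek.
  by rewrite addn0 -ltnS ltn_ord spectral0 invrK.
rewrite spectral_raise // invfM (IHk _ (ltnW lek)) val_ordS.
have ltk : (k <= n)%N by [].
case: eqVneq => [->|_] /=.
  have -> : (n + k.+1 <= n)%N = false by lia.
  have -> : (n + k.+1 - n.+1 = k)%N by lia.
  by rewrite add0n ltk.
by rewrite invr1 mul1r addSn addnS.
Qed.

(* Both sides are affine in the inverse spectral point of [alpha], and the *)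
(* points indexed by the [row k] determine an affine function. *)
Lemma ratio_box alpha : dual_ratio alpha (raise 0%MM) = weight alpha / weight 0%MM.
Proof.
have := O_size (raise 0%MM); rewrite mdeg_raise mdeg0 => /affine_meval[c0 [c OE]].
have RE beta : dual_ratio beta (raise 0%MM) = c0 + \sum_i c i * (bar beta i)^-1.
  by rewrite -O_val OE.
(* [weight beta] is itself affine in the inverse point, so [d0] and [d] are the coefficients of the
   difference of the two sides; all of them must vanish. *)
pose d0 := c0 + 1 / weight 0%MM.
pose d (i : 'I_n.+1) := c i - a / weight 0%MM * (i == ord0)%:R.
have dE beta : dual_ratio beta (raise 0%MM) - weight beta / weight 0%MM =
    d0 + \sum_i d i * (bar beta i)^-1.
  rewrite RE [X in _ = _ + X](eq_bigr (fun i => c i * (bar beta i)^-1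
    - a / weight 0%MM * (i == ord0)%:R * (bar beta i)^-1)); last by move=> i _; rewrite /d mulrBl.
  have pick : \sum_i a / weight 0%MM * (i == ord0)%:R * (bar beta i)^-1 =
      a / weight 0%MM * (bar beta ord0)^-1.
    rewrite (bigD1 ord0) //= mulr1 big1 ?addr0 // => i /negPf->.
    by rewrite mulr0 mul0r.
  rewrite big_split sumrN /= pick.
  by rewrite /d0 [weight beta]/weight; ring.
pose S k := \sum_i d i * (bar (row k) i)^-1.
have SE k : S k = - d0.
  by apply/eqP; rewrite -addr_eq0 addrC -dE ratio_row_box subrr.
have d00 : d0 = 0.
  (* A full turn of the window multiplies the point by q^-1, while [S] is constant. *)
  have e : S n.+1 = q^-1 * S 0%N.
    rewrite /S mulr_sumr; apply: eq_bigr => i _; rewrite mulrCA; congr (_ * _).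
    rewrite (row_barV i (leqnn _)) (row_barV (k := 0) i (leq0n _)).
    have -> : (i + n.+1 <= n)%N = false by lia.
    by rewrite addnK addn0 -ltnS ltn_ord.
  move: e; rewrite !SE mulrN => /oppr_inj/esym/eqP.
  rewrite -subr_eq0 -{2}[d0]mul1r -mulrBl mulf_eq0 subr_eq0 => /orP[|/eqP//].
  rewrite invr_eq1 => /eqP q1; case: qt_gen => _ _ /(_ 1%N 0%N 0%N 0%N).
  by rewrite q1 !expr0 expr1 => /(_ erefl).
have d_eq0 (i : 'I_n.+1) : d i = 0.
  have lti := ltn_ord i; have lek : (n - i <= n)%N by apply: leq_subr.
  (* Consecutive terms of the sequence differ by the factor t except in passing from t^n to q^-1,
     and these two rows see that jump at coordinate [i] only. *)
  have diff (j : 'I_n.+1) : (bar (row (n - i).+1) j)^-1 - t * (bar (row (n - i)) j)^-1 =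
      (j == i)%:R * (q^-1 - t ^+ n.+1).
    rewrite (row_barV j (lek : ((n - i).+1 <= n.+1)%N)) (row_barV j (leqW lek)) addnS.
    have [->|] := eqVneq j i.
      by rewrite subnKC // ltnn leqnn subnn mulr1 mul1r exprS.
    rewrite -val_eqE /= mul0r => nji; have [le1|gt1] := leqP (j + (n - i)).+1 n.
      by rewrite (ltnW le1) exprS subrr.
    have [le2|gt2] := leqP (j + (n - i)) n; first lia.
    by rewrite subSn // exprS mulrCA subrr.
  have : S (n - i).+1 - t * S (n - i)%N = d i * (q^-1 - t ^+ n.+1).
    rewrite /S mulr_sumr -sumrB (bigD1 i) // big1 => [|j /negPf nji].
      by rewrite Monoid.mulm1 mulrCA -mulrBr diff eqxx mul1r.
    by rewrite mulrCA -mulrBr diff nji mul0r mulr0.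
  rewrite !SE d00 oppr0 mulr0 subrr => /esym/eqP; rewrite mulf_eq0 => /orP[/eqP//|].
  rewrite subr_eq0 => /eqP e; case: qt_gen => _ _ /(_ 0%N 0%N 1%N n.+1).
  by rewrite !expr0 expr1 mul1r -e mulfV // => /(_ erefl).
apply/eqP; rewrite -subr_eq0 dE d00 add0r big1 // => i _.
by rewrite d_eq0 mul0r.
Qed.

Lemma ratio_raiseE alpha beta :
  weight beta * dual_ratio alpha (raise beta) = weight alpha * dual_ratio (raise alpha) beta.
Proof.
by rewrite ratio_raise ratio_box (mulrC (weight 0%MM)) divfK ?weight_neq0.
Qed.

(** * Exchange of adjacent parts *)

Section Hecke.
Variables (i j : 'I_n.+1) (ij : j = i.+1 :> nat).

Let s (x : 'I_n.+1 -> L) k := x (tperm i j k).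

(* [T] is the image of [P] under *)
(* [f -> (x_i - t x_(i+1)) / (x_i - x_(i+1)) * (f (s_i x) - f x)]. *)
Lemma demazure_lusztig (P : {mpoly L[n.+1]}) : exists2 T : {mpoly L[n.+1]},
  (msize T <= maxn 1 (msize P))%N & forall x,
  (x i - x j) * T.@[x] = (x i - t * x j) * (P.@[s x] - P.@[x]) /\
  (x i = t * x j -> T.@[x] = 0).
Proof.
have [|||D sD] := msubst_divide (h := fun k => 'X_(tperm i j k)) (h' := fun k => 'X_k)
  (l := 'X_i - 'X_j) (eps := fun k => (k == j)%:R - (k == i)%:R) P.
- by move=> k; rewrite msize_XU.
- by move=> k; rewrite msize_XU.
- have nij : (i == j) = false by rewrite -val_eqE /= ij; lia.
  move=> k; case: tpermP => [->|->|/eqP/negPf-> /eqP/negPf->].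
  + by rewrite eqxx nij sub0r scaleN1r opprB.
  + by rewrite eqxx eq_sym nij subr0 scale1r.
  by rewrite !subrr scale0r.
rewrite [X in _ - X]msubst_id // => DE.
exists (('X_i - t *: 'X_j) * D).
  apply: leq_trans (msizeM_leq _ _) _.
  have : (msize ('X_i - t *: 'X_j : {mpoly L[n.+1]}) <= 2)%N.
    by apply: msizeB_leq; rewrite ?msizeZ_leq ?msize_XU.
  by move: sD; lia.
move=> x; have := congr1 (meval x) DE.
rewrite !mevalM !mevalB mevalZ !mevalXU msubst_eval.
rewrite (@meval_eq _ _ _ (s x)) => [->|k]; last by rewrite mevalXU.
by split=> [|->]; [ring | rewrite subrr mul0r].
Qed.

(** It vanishes when the two parts are equal, which is when the reflected point need not be
    spectral. *)
Definition hecke_coef alpha : L :=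
  (bar alpha i - t * bar alpha j) / (bar alpha i - bar alpha j).

Lemma hecke_coef_eq0 alpha : alpha i = alpha j -> hecke_coef alpha = 0.
Proof. by move=> /(spectral_eq qt_gen ij) e; rewrite /hecke_coef -e subrr mul0r. Qed.

Lemma hecke_coef_neq0 alpha : alpha i != alpha j -> hecke_coef alpha != 0.
Proof.
move=> nij; rewrite mulf_neq0 ?invr_eq0 ?subr_eq0 ?spectral_neq_t //.
by apply: contra_neq nij => /(spectral_inj qt_gen).
Qed.

(** At a spectral point with equal parts at [i] and [j] the factor x_i - t x_j kills [T]; at any
    other, the reflected point is again spectral. So, in degree at most |alpha|, [T] can be nonzero
    only at [alpha] and its exchange, and unisolvence places it in the span of the two
    polynomials. *)
Lemma g_mswap alpha : exists2 T : {mpoly L[n.+1]},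
  exists c, T = c *: g (mswap i j alpha) - hecke_coef alpha *: g alpha & forall x,
  (x i - x j) * T.@[x] = (x i - t * x j) * ((g alpha).@[s x] - (g alpha).@[x]) /\
  (x i = t * x j -> T.@[x] = 0).
Proof.
have [T sT TE] := demazure_lusztig (g alpha); exists T => //.
set sa := mswap i j alpha.
(* Forced by comparing values at the spectral point of [sa]. *)
pose c := hecke_coef sa * (g alpha).@[bar alpha] / (g sa).@[bar sa].
exists c; apply/eqP; rewrite -subr_eq0; apply/eqP.
apply: (spectral_unisolvent qt_gen (d := mdeg alpha)).
  apply: msizeB_leq; first by apply: leq_trans sT _; rewrite geq_max g_size.
  by apply: msizeB_leq; apply: msizeZ_leq; rewrite // -(mdeg_mswap i j alpha).
move=> beta degb; rewrite !mevalB !mevalZ.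
have degs : (mdeg beta <= mdeg sa)%N by rewrite mdeg_mswap.
have van b : (mdeg b <= mdeg alpha)%N -> b != alpha -> (g alpha).@[bar b] = 0.
  exact: g_vanish.
have [eb|nb] := eqVneq (beta i) (beta j).
  rewrite ((TE _).2 (spectral_eq qt_gen ij eb)) sub0r.
  have [ba|nba] := eqVneq beta alpha.
    have saE : sa = alpha by rewrite /sa mswap_id // -ba.
    have ea : alpha i = alpha j by rewrite -ba.
    by rewrite /c saE hecke_coef_eq0 // !mul0r subrr oppr0.
  rewrite (van _ degb nba) mulr0 subr0.
  have [bs|nbs] := eqVneq beta sa; last by rewrite (g_vanish degs nbs) mulr0 oppr0.
  have es : sa i = sa j by rewrite -bs.
  by rewrite /c hecke_coef_eq0 // !mul0r oppr0.
have TbE : T.@[bar beta] =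
    hecke_coef beta * ((g alpha).@[bar (mswap i j beta)] - (g alpha).@[bar beta]).
  have nz : bar beta i - bar beta j != 0.
    by rewrite subr_eq0; apply: contra_neq nb => /(spectral_inj qt_gen).
  apply: (mulfI nz); rewrite (TE _).1 /hecke_coef.
  rewrite (meval_eq _ (v2 := bar (mswap i j beta))) => [|k].
    by field.
  by rewrite spectral_mswap.
have nsb : mswap i j beta != beta.
  apply: contra_neq nb => /(congr1 (fun m : 'X_{1..n.+1} => m i)).
  by rewrite mnmE tpermL.
rewrite TbE; have [ba|nba] := eqVneq beta alpha.
  have sE : mswap i j beta = sa by rewrite ba.
  rewrite sE (van sa) ?(g_vanish degs) -?sE ?ba; last first.
  - by rewrite ba in nsb.
  - by rewrite mdeg_mswap.
  - by rewrite eq_sym; rewrite ba in nsb.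
  by ring.
rewrite (van _ degb nba) mulr0 !subr0.
have [bs|nbs] := eqVneq beta sa.
  by rewrite {2}bs /sa mswapK bs /c divfK ?subrr // g_bar_neq0.
rewrite (g_vanish degs nbs) mulr0 subr0 van ?mulr0 ?mdeg_mswap //.
by apply: contra_neq nbs => e; rewrite /sa -e mswapK.
Qed.

End Hecke.

Lemma rev_ordS (i j : 'I_n.+1) : j = i.+1 :> nat -> rev_ord i = (rev_ord j).+1 :> nat.
Proof. by move=> ij /=; have := ltn_ord j; lia. Qed.

Lemma dual_mswap i j beta : beta (rev_ord j) != beta (rev_ord i) ->
  forall ij : j = i.+1 :> nat,
  (fun k => dual beta (tperm i j k)) =1 dual (mswap (rev_ord j) (rev_ord i) beta).
Proof.
move=> nb ij k; rewrite /dual (spectral_mswap q t (rev_ordS ij)) //; congr (_ / bar beta _).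
rewrite tpermC; case: tpermP => [->|->|ki kj]; rewrite ?tpermL ?tpermR //.
by rewrite tpermD // (inj_eq rev_ord_inj) eq_sym; apply/eqP.
Qed.

(** Evaluate the same [T] at dual points: inversion and reversal turn its coefficient into
    [hecke_coef] at the reversed positions. At [beta = 0] all parts are equal, so [T] vanishes
    there, which determines the constant of [g_mswap]. *)
Lemma ratio_mswap (i j : 'I_n.+1) alpha beta : j = i.+1 :> nat ->
  hecke_coef i j alpha * (dual_ratio (mswap i j alpha) beta - dual_ratio alpha beta) =
  hecke_coef (rev_ord j) (rev_ord i) beta *
    (dual_ratio alpha (mswap (rev_ord j) (rev_ord i) beta) - dual_ratio alpha beta).
Proof.
move=> ij; have [T [c Tc] TE] := g_mswap ij alpha.
have Tdual b : T.@[dual b] = hecke_coef (rev_ord j) (rev_ord i) b *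
    (G alpha (mswap (rev_ord j) (rev_ord i) b) - G alpha b).
  have [eb|nb] := eqVneq (b (rev_ord j)) (b (rev_ord i)).
    rewrite (hecke_coef_eq0 (rev_ordS ij)) // mul0r (TE _).2 //.
    by rewrite /dual (spectral_eq qt_gen (rev_ordS ij) eb); field; rewrite t_neq0 expf_neq0 // spectral_neq0.
  have nz : dual b i - dual b j != 0.
    rewrite subr_eq0 (inj_eq (mulfI _)) ?mulf_neq0 ?invr_eq0 ?expf_neq0 //.
    rewrite (inj_eq invr_inj) eq_sym; apply: contra_neq nb; exact: spectral_inj.
  apply: (mulfI nz); rewrite (TE _).1 (meval_eq _ (dual_mswap nb ij)) /hecke_coef /dual.
  have nz' : bar b (rev_ord j) - bar b (rev_ord i) != 0.
    by rewrite subr_eq0; apply: contra_neq nb; apply: spectral_inj.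
  by field; rewrite nz' expf_neq0 // !spectral_neq0.
have := Tdual 0%MM; rewrite (hecke_coef_eq0 (rev_ordS ij)) ?mnm0E // mul0r.
have := Tdual beta; rewrite Tc !mevalB !mevalZ /dual_ratio => e1 /eqP.
rewrite subr_eq0 => /eqP e0.
have cE : c = hecke_coef i j alpha * G alpha 0%MM / G (mswap i j alpha) 0%MM.
  by rewrite -e0 mulfK.
by rewrite -[in RHS]mulrBl [RHS]mulrA -e1 cE; field; rewrite !G0_neq0.
Qed.

Theorem ratio_sym alpha beta : dual_ratio alpha beta = dual_ratio beta alpha.
Proof.
elim/composition_ind: alpha beta => [|alpha IH|i j alpha ij nij IH] beta.
- by rewrite ratio0l ratio0r.
- apply: (mulfI (weight_neq0 alpha)).
  by rewrite -ratio_raiseE IH ratio_raiseE.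
apply: (addIr (- dual_ratio alpha beta)); apply: (mulfI (hecke_coef_neq0 nij)).
(* [IH] transposes the right-hand side of [ratio_mswap], and the result is the left-hand side of its
   instance with the arguments exchanged and the positions reversed. *)
rewrite ratio_mswap // !IH.
by have := ratio_mswap beta alpha (rev_ordS ij); rewrite !rev_ordK => <-.
Qed.

(** Inverse spectral points are the spectral points for q^-1 and t^-1, so comparing values there
    suffices. The substitution carries the inverse point of [beta] to [dual beta], and [ratio_sym]
    matches the values. *)
Theorem O_polynomial_eq alpha :
  O alpha = (G alpha 0%MM)^-1 *: msubst (fun i => (a / t ^+ n) *: 'X_(rev_ord i)) (g alpha).
Proof.
apply/eqP; rewrite -subr_eq0; apply/eqP.
apply: (spectral_unisolvent (generic_inv qt_gen) (d := mdeg alpha)).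
  apply: msizeB_leq => //; apply: msizeZ_leq; apply: leq_trans (g_size alpha).
  by apply: msize_msubst => i; apply: msizeZ_leq; rewrite msize_XU.
move=> beta _; rewrite -(@meval_eq _ _ (fun i => (bar beta i)^-1)); last first.
  by move=> i; rewrite spectral_inv.
rewrite mevalB O_val mevalZ msubst_eval ratio_sym /dual_ratio mulrC.
rewrite [X in _ - _ * X](meval_eq _ (v2 := dual beta)) ?subrr // => i.
by rewrite mevalZ mevalXU.
Qed.

End Duality.

(** * Specialization to Q(q, t, a) *)

Lemma mpolyX_neq0 (R : nzRingType) n (m : 'X_{1..n}) : 'X_[m] != 0 :> {mpoly R[n]}.
Proof. by rewrite -msize_poly_eq0 msizeX. Qed.

Lemma QQqt_generic : generic q t.
Proof.
split; rewrite ?tofrac_eq0 ?mpolyX_neq0 //.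
move=> m k m' k' /eqP; rewrite /q /t -!tofracXn -!tofracM tofrac_eq !mpolyXn -!mpolyXD.
set u := (X in 'X_[X] == _); set v := (X in _ == 'X_[X]) => /eqP uv.
have /(congr1 (fun u : 'X_{1..2} => u ord0)) : u = v.
  apply/eqP; have := congr1 (mcoeff v) uv.
  by rewrite !mcoeffX eqxx; case: (u == v) => // /eqP; rewrite eq_sym oner_eq0.
by rewrite !mnmDE !mulmnE !mnm1E /= !mul1n !mul0n !addn0.
Qed.

Lemma toK_inj : injective toK.
Proof. exact: fmorph_inj. Qed.

Lemma QQqta_generic : generic (toK q) (toK t).
Proof.
have [q0 t0 qt] := QQqt_generic.
split; [by rewrite fmorph_eq0 | by rewrite fmorph_eq0 |].
have toKE m k : toK q ^+ m * toK t ^+ k = toK (q ^+ m * t ^+ k).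
  by rewrite rmorphM !rmorphXn.
by move=> m k m' k'; rewrite !toKE => /toK_inj/qt.
Qed.

Lemma a_neq0 : a != 0.
Proof. by rewrite tofrac_eq0 polyX_eq0. Qed.

Lemma a_generic m k : a * toK t ^+ k != toK q ^+ m.
Proof.
have t0 : t ^+ k != 0 by case: QQqt_generic => _ t0 _; rewrite expf_neq0.
have -> : a * toK t ^+ k = tofrac ('X * (t ^+ k)%:P) by rewrite tofracM -(rmorphXn toK).
have -> : toK q ^+ m = tofrac (q ^+ m)%:P by rewrite -(rmorphXn toK).
rewrite tofrac_eq.
(* The left side has degree 1 in [a], the right side is constant. *)
apply/eqP => /(congr1 (fun p : {poly QQqt} => size p)).
rewrite mulrC mul_polyC size_scale // size_polyX => e.
by have := size_polyC_leq1 (q ^+ m); rewrite -e.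
Qed.

Section Scalars.
Variable n : nat.
Implicit Type P : {mpoly QQqt[n]}.

Lemma scalars_to_K_eval P v : (scalars_to_K P).@[fun i => toK (v i)] = toK P.@[v].
Proof.
rewrite [LHS]mevalE (perm_big _ (msupp_map_mpoly _ toK_inj)) mevalE (rmorph_sum toK).
apply: eq_bigr => m _ /=; rewrite mcoeff_map_mpoly (rmorphM toK) (rmorph_prod toK).
by congr (_ * _); apply: eq_bigr => i _; rewrite (rmorphXn toK).
Qed.

Lemma msize_scalars_to_K P : msize (scalars_to_K P) = msize P.
Proof. by rewrite !msizeE (perm_big _ (msupp_map_mpoly _ toK_inj)). Qed.

End Scalars.

Lemma bar_spectral n (beta : 'X_{1..n}) i :
  toK (bar (intv beta) i) = spectral (toK q) (toK t) beta i.
Proof. by rewrite /bar rmorphM fmorphV !rmorphXn kstat_rank. Qed.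

(** Negation together with reversal reverses the sorting order, so each index other than [i] is
    counted by exactly one of the two statistics. *)
Lemma kstat_opp n (alpha : 'X_{1..n.+1}) i :
  (kstat (fun k => - w0 (intv alpha) k) i + rank alpha (rev_ord i))%N = n.
Proof.
rewrite /kstat /rank (reindex_inj rev_ord_inj) !card_set_sum -!big_split /=.
rewrite (eq_bigr (fun k => (k != i) : nat)).
  by rewrite -card_set_sum cardsE cardC1 card_ord.
move=> k _; rewrite /beats /w0 /intv -val_eqE /=.
have := ltn_ord i; have := ltn_ord k => ltk lti.
have [/val_inj->|nki] := eqVneq (k : nat) i; first lia.
lia.
Qed.

Lemma dual_opp (L : fieldType) (x y z : L) n (alpha : 'X_{1..n.+1}) i :
  x != 0 -> y != 0 -> dual x y z alpha i =
  z * (x ^ (- w0 (intv alpha) i) * y ^- kstat (fun k => - w0 (intv alpha) k) i).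
Proof.
move=> x0 y0; rewrite /dual /spectral -exprnN.
have -> : y ^+ n = y ^+ kstat (fun k => - w0 (intv alpha) k) i * y ^+ rank alpha (rev_ord i).
  by rewrite -exprD kstat_opp.
by field; rewrite !expf_neq0.
Qed.

Lemma tilde_dual n (alpha : 'X_{1..n.+1}) i :
  a * toK (tilde (intv alpha) i) = dual (toK q) (toK t) a alpha i.
Proof.
have [q0 t0 _] := QQqta_generic; rewrite dual_opp //; congr (_ * _).
by rewrite /tilde /bar (rmorphM toK) fmorphV (rmorphXn toK) (fmorphXz toK).
Qed.

Lemma dual0 (L : fieldType) (x y z : L) n (i : 'I_n.+1) :
  y != 0 -> dual x y z 0%MM i = z * y ^- i.
Proof.
move=> y0; rewrite /dual spectral0 invrK -mulrA; congr (_ * _).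
have -> : y ^+ n = y ^+ i * y ^+ rev_ord i.
  by rewrite -exprD; congr (_ ^+ _); rewrite /=; have := ltn_ord i; lia.
by field; rewrite !expf_neq0.
Qed.

Lemma tau_dual n (i : 'I_n.+1) : a * toK (tau i) = dual (toK q) (toK t) a 0%MM i.
Proof.
have [_ t0 _] := QQqta_generic; rewrite dual0 //; congr (_ * _).
by rewrite /tau fmorphV (rmorphXn toK).
Qed.

Unset Implicit Arguments.

Theorem theoremC (n : nat) (n_gt0 : (0 < n)%N)
    (G : 'X_{1..n} -> {mpoly QQqt[n]}) (O : 'X_{1..n} -> {mpoly QQqta[n]})
    (HG : forall alpha : 'X_{1..n}, is_interpolation_Macdonald alpha (G alpha))
    (HO : forall alpha : 'X_{1..n}, is_O_polynomial G alpha (O alpha))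
    (alpha : 'X_{1..n}) :
  O alpha =
    (eval_a (G alpha) (@tau n))^-1 *:
      (scalars_to_K (G alpha) \mPo
         [tuple (toK (t ^ (1 - n%:Z)) * a) *:
                  w0 (fun k : 'I_n => 'X_k : {mpoly QQqta[n]}) i | i < n]).
Proof.
case: n n_gt0 G O HG HO alpha => // n _ G O HG HO alpha.
have tildeE beta gam : eval_a (G beta) (tilde (intv gam)) =
    (scalars_to_K (G beta)).@[dual (toK q) (toK t) a gam].
  by apply: meval_eq => i; rewrite tilde_dual.
have tauE beta : eval_a (G beta) (@tau n.+1) =
    (scalars_to_K (G beta)).@[dual (toK q) (toK t) a 0%MM].
  by apply: meval_eq => i; rewrite tau_dual.
have size_g beta : (msize (scalars_to_K (G beta)) <= (mdeg beta).+1)%N.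
  by rewrite msize_scalars_to_K; case: (HG beta).
have vanish_g beta gam : (mdeg gam <= mdeg beta)%N -> gam != beta ->
    (scalars_to_K (G beta)).@[spectral (toK q) (toK t) gam] = 0.
  case: (HG beta) => _ van _ deg_gam ngam.
  rewrite -(meval_eq _ (bar_spectral gam)) scalars_to_K_eval van //.
have coef_g beta : (scalars_to_K (G beta))@_beta = 1.
  rewrite mcoeff_map_mpoly; case: (HG beta) => _ _ ->; exact: (rmorph1 toK).
have g_neq0 beta : scalars_to_K (G beta) != 0.
  apply/eqP => g0; have := coef_g beta.
  by rewrite g0 mcoeff0 => /esym/eqP; rewrite oner_eq0.
have O_val beta gam : (O beta).@[fun i => (spectral (toK q) (toK t) gam i)^-1] =
    dual_ratio (toK q) (toK t) a (fun al => scalars_to_K (G al)) gam beta.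
  rewrite /dual_ratio -tauE -tildeE -(HO beta).2.
  by apply: meval_eq => i; rewrite bar_spectral.
(* [O 0] is a constant, with value [x / x] at the point indexed by [beta], *)
(* where [x] is [G_beta(a tau)], and [1 / 1] at the point indexed by [0]. *)
have g_tau_neq0 beta : (scalars_to_K (G beta)).@[dual (toK q) (toK t) a 0%MM] != 0.
  have := (HO 0%MM).1; rewrite mdeg0 => /msize1_polyC OE.
  have := O_val 0%MM beta; rewrite -[LHS](_ : (O 0%MM)@_0 = _); last by rewrite {2}OE mevalC.
  have := O_val 0%MM 0%MM; rewrite -[LHS](_ : (O 0%MM)@_0 = _); last by rewrite {2}OE mevalC.
  move=> ->; rewrite /dual_ratio; have := size_g 0%MM; rewrite mdeg0 => /msize1_polyC ->.
  rewrite !mevalC coef_g divr1 => e; apply/eqP => g0; move/eqP: e.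
  by rewrite g0 mul0r oner_eq0.
rewrite (O_polynomial_eq QQqta_generic a_neq0 a_generic size_g vanish_g g_neq0 g_tau_neq0
  (fun beta => (HO beta).1) O_val) tauE; congr (_ *: _).
apply: eq_msubst => i; rewrite /w0; congr (_ *: _).
rewrite mulrC; congr (_ * _).
have -> : 1 - n.+1%:Z = - n%:Z by lia.
by rewrite -exprnN fmorphV rmorphXn.
Qed.
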